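(* Let $0<q<1$, let $a,b,c,d,r,u,v$ be complex numbers with $\max\{|a|,|b|,|c|,|d|,|r|\}<1$, and put $\alpha=a^2bcdr/q$. Then \begin{align*} &\sum_{n=0}^\infty \frac{(\alpha uv/q, ab, ac, ad, ar; q)_n (bcdr)^n}{(q, \alpha u, \alpha v, abcd, abcr; q)_n}\, {}_3\phi_2\left({{abq^n, acq^n, bc}\atop{abcdq^n, abcrq^n}}; q, dr\right)\\ &=\frac{(abdr, acdr; q)_\infty}{( dr, q\alpha; q)_\infty} \sum_{n=0}^\infty \frac{(1-\alpha q^{2n})(\alpha, ab, ac, ad, ar, q/u, q/v; q)_n}{(1-\alpha)(q, abcd, abcr, abdr, acdr, \alpha u, \alpha v; q)_n} \left(-\frac{\alpha bcdruv}{q}\right)^n q^{n(n-1)/2}. \end{align*}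
   Context: For $0<q<1$: $(a;q)_n=\prod_{k=0}^{n-1}(1-aq^k)$, $(a;q)_\infty=\prod_{k\ge0}(1-aq^k)$, $(a_1,\dots,a_m;q)_n=(a_1;q)_n\cdots(a_m;q)_n$. ${}_{3}\phi_2\left({{a_1,a_2,a_3}\atop{b_1,b_2}};q,z\right)=\sum_{n\ge0}\frac{(a_1,a_2,a_3;q)_n}{(q,b_1,b_2;q)_n}z^n$. *)

(* Defs.v *)
From mathcomp Require Import all_boot all_order all_algebra.
From mathcomp Require Import all_classical all_reals all_analysis.
From mathcomp Require Export complex.
Set Implicit Arguments.
Unset Strict Implicit.
Unset Printing Implicit Defensive.
Import Order.TTheory GRing.Theory Num.Theory numFieldNormedType.Exports.
Local Open Scope ring_scope.

(* Everything is defined over an arbitrary [numFieldType] because this is where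
   the library puts the topology induced by the norm; it is used at [R[i]] with
   [R : realType], where [`|_|] is the complex modulus. *)

Definition qpoch (K : numFieldType) (q a : K) (n : nat) : K :=
  \prod_(k < n) (1 - a * q ^+ k).

Definition qpoch_inf (K : numFieldType) (q a : K) : K :=
  limn (fun n => qpoch q a n).

(* (a_1, ..., a_m; q)_n *)
Definition qpochs (K : numFieldType) (q : K) (s : seq K) (n : nat) : K :=
  \prod_(a <- s) qpoch q a n.

(* (a_1, ..., a_m; q)_oo *)
Definition qpochs_inf (K : numFieldType) (q : K) (s : seq K) : K :=
  \prod_(a <- s) qpoch_inf q a.

(* [limn] is total, so these two are meant to be used together. *)
Definition summable_series (K : numFieldType) (f : nat -> K) : Prop :=
  cvgn (series f).

Definition sum_series (K : numFieldType) (f : nat -> K) : K :=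
  limn (series f).

Definition phi32_term (K : numFieldType) (q a1 a2 a3 b1 b2 z : K) (n : nat) : K :=
  qpochs q [:: a1; a2; a3] n / qpochs q [:: q; b1; b2] n * z ^+ n.

Definition phi32 (K : numFieldType) (q a1 a2 a3 b1 b2 z : K) : K :=
  sum_series (phi32_term q a1 a2 a3 b1 b2 z).

(* Main.v *)
Require Import Defs.
From mathcomp Require Import all_boot all_order all_algebra.
From mathcomp Require Import all_classical all_reals all_analysis.
From mathcomp Require Import ring zify.
Set Implicit Arguments.
Unset Strict Implicit.
Unset Printing Implicit Defensive.
Import Order.TTheory GRing.Theory Num.Theory numFieldNormedType.Exports.
Local Open Scope classical_set_scope.
Local Open Scope ring_scope.
Local Open Scope complex_scope.

(** By the q-Saalschütz sum, [(q/u, q/v; q)_n / (alpha u, alpha v; q)_n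
    (alpha u v / q)^n] is a terminating sum over [m <= n] with numerator
    [(q^-n, alpha q^n, alpha u v / q; q)_m]. Insert it in the right-hand side and
    exchange the two sums. With [n = m + j] the inner sum over [j] is again very
    well poised, with [a] replaced by [a q^m], and so the theorem reduces to
      3phi2 (B, C, w; Dw, Ew; t)
        = (Bt, Ct)_oo / (t, alpha q)_oo * (a very-well-poised series),
    where [B C t = D E w = alpha q], [B, C, D, E = ab, ac, ad, ar], [w = bc] and
    [t = dr]. This is Bailey's lemma: the Bailey pair with
    [beta_n = (w)_n / (q, Dw, Ew)_n] turns the left-hand side into a double sum,
    and the exchanged inner sum is the nonterminating q-Gauss sum. *)

(** * Convergence *)

(** The only form of completeness used: every series in the proof is dominated geometrically.
    Isolating it keeps the argument over an arbitrary [numFieldType] until the end. *)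
Definition geometrically_complete (K : numFieldType) : Prop :=
  forall (f : nat -> K) (M rho : K), 0 <= rho -> rho < 1 ->
    (forall n, `|f n| <= M * rho ^+ n) -> cvgn (series f).

(** Being nonnegative, [M] and [rho] are real, so the real and imaginary parts of [f] are dominated
    by a real geometric series. *)
Lemma complex_geometrically_complete (R : realType) :
  geometrically_complete R[i].
Proof.
move=> f M rho rho_ge0 rho_lt1 f_le.
have rhoE : rho = (complex.Re rho)%:C by rewrite RRe_real // ger0_real.
have M_ge0 : 0 <= M by have := f_le 0%N; rewrite expr0 mulr1; apply: le_trans.
have ME : M = (complex.Re M)%:C by rewrite RRe_real // ger0_real.
have r_lt1 : `|complex.Re rho| < 1.
  by rewrite ger0_norm -?ltcR -?lecR -rhoE.
have bound (g : nat -> R) : (forall n, `|g n| <= complex.Re M * complex.Re rho ^+ n) ->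
    cvgn (series g).
  move=> g_le; apply: normed_cvg.
  apply: (@series_le_cvg _ _ (geometric (complex.Re M) (complex.Re rho))).
  - by move=> n /=.
  - by move=> n; exact: le_trans (normr_ge0 _) (g_le n).
  - exact: g_le.
  - exact: (is_cvg_geometric_series r_lt1).
have dom n : `|f n| <= (complex.Re M * complex.Re rho ^+ n)%:C.
  by have := f_le n; rewrite {1}ME {1}rhoE -rmorphXn -rmorphM.
have /cvg_ex[x cvx] : cvgn (series (fun n => complex.Re (f n))).
  apply: bound => n; rewrite -lecR; apply: le_trans (dom n).
  exact: normc_ge_Re.
have /cvg_ex[y cvy] : cvgn (series (fun n => complex.Im (f n))).
  apply: bound => n; rewrite -lecR; apply: le_trans (dom n).
  (* The imaginary part of a number is, up to sign, the real part of its product with ['i%C]. *)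
  by have := normc_ge_Re ('i%C * f n); rewrite mulrC ReiNIm normrN normrM
     (_ : `|'i%C| = 1) ?mulr1 // normc_def /= expr0n /= add0r expr1n sqrtr1.
have sE N : series f N = (series (fun n => complex.Re (f n)) N) +i*
     (series (fun n => complex.Im (f n)) N).
  rewrite /series /=; elim: N => [|N IH]; first by rewrite !big_geq.
  by rewrite !big_nat_recr //= IH; case: (f N).
apply/cvg_ex; exists (x +i* y).
apply/cvgrPdist_lt => e e_gt0.
have eE : e = (complex.Re e)%:C by rewrite RRe_real // gtr0_real.
have e2_gt0 : 0 < complex.Re e / 2 by rewrite divr_gt0 // -ltcR -eE.
move/cvgrPdist_lt : cvx => /(_ _ e2_gt0) cvx.
move/cvgrPdist_lt : cvy => /(_ _ e2_gt0) cvy.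
near=> N.
have -> : x +i* y - series f N =
    (x - series (fun n => complex.Re (f n)) N)%:C
    + 'i%C * (y - series (fun n => complex.Im (f n)) N)%:C.
  by rewrite sE; simpc.
rewrite (le_lt_trans (ler_normD _ _)) // normrM.
rewrite (_ : `|'i%C| = 1) ?mul1r; last first.
  by rewrite normc_def /= expr0n /= add0r expr1n sqrtr1.
have nC (z : R) : `|z%:C| = `|z|%:C.
  by rewrite normc_def /= expr0n addr0 sqrtr_sqr.
rewrite !nC -rmorphD eE ltcR [ltRHS](splitr (complex.Re e)) ltrD //.
- by near: N.
- by near: N.
Unshelve. all: by end_near.
Qed.

(** A [numFieldType] can be non-Archimedean, so this is not automatic; completeness gives it, the
    powers being the terms of a convergent series. *)
Lemma cvg_exp0 (K : numFieldType) (K_complete : geometrically_complete K)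
    (rho : K) : 0 <= rho -> rho < 1 -> (fun n => rho ^+ n) @ \oo --> (0 : K).
Proof.
move=> rho_ge0 rho_lt1; apply: cvg_series_cvg_0.
apply: (K_complete _ 1 rho) => // n.
by rewrite mul1r normrX ger0_norm.
Qed.

Lemma cvg_dominated (K : numFieldType) (K_complete : geometrically_complete K)
    (u : nat -> K) (l M rho : K) : 0 <= rho -> rho < 1 ->
  (forall n, `|l - u n| <= M * rho ^+ n) -> u @ \oo --> l.
Proof.
move=> rho_ge0 rho_lt1 u_le.
have M_ge0 : 0 <= M by have := u_le 0%N; rewrite expr0 mulr1; apply: le_trans.
(* [M] may be 0, while [M + 1] can be divided by. *)
have M1_gt0 : 0 < M + 1 by rewrite ltr_wpDl.
apply/cvgrPdist_lt => e e_gt0.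
have /cvgrPdist_lt/(_ (e / (M + 1))) := cvg_exp0 K_complete rho_ge0 rho_lt1.
rewrite divr_gt0 // => /(_ isT) near_rho.
near=> n.
have : `|0 - rho ^+ n| < e / (M + 1) by near: n.
rewrite sub0r normrN ger0_norm ?exprn_ge0 // ltr_pdivlMr // mulrC => h.
apply: le_lt_trans (u_le n) (le_lt_trans _ h).
by rewrite ler_wpM2r ?exprn_ge0 // lerDl.
Unshelve. all: by end_near.
Qed.

Lemma norm_lim_le (K : numFieldType) (u : nat -> K) (l B : K) (N : nat) :
  u @ \oo --> l -> (forall n, (N <= n)%N -> `|u n| <= B) -> `|l| <= B.
Proof.
move=> ul u_le.
(* The order is partial: [B] has to be real before the negation of the claim yields a strict
   inequality. *)
have B_real : B \is Num.real.
  by rewrite ger0_real // (le_trans _ (u_le N _)).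
rewrite real_leNgt ?normr_real //; apply/negP => B_lt.
move/cvgrPdist_lt : ul => /(_ (`|l| - B)); rewrite subr_gt0 => /(_ B_lt) near_u.
near \oo => n.
have : `|l - u n| < `|l| - B by near: n.
rewrite ltrBrDr => h.
have : `|l| < `|l|.
  apply: le_lt_trans h; rewrite -{1}(subrK (u n) l).
  apply: le_trans (ler_normD _ _) _; rewrite lerD2l.
  by apply: u_le; near: n; exists N.
by rewrite ltxx.
Unshelve. all: by end_near.
Qed.

Lemma sum_geometric_le (K : numFieldType) (rho : K) (m n : nat) :
  0 <= rho -> rho < 1 ->
  \sum_(m <= k < n) rho ^+ k <= rho ^+ m / (1 - rho).
Proof.
move=> rho_ge0 rho_lt1.
have r_gt0 : 0 < 1 - rho by rewrite subr_gt0.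
case: (leqP m n) => [mn|nm]; last first.
  by rewrite big_geq ?(ltnW nm) // divr_ge0 ?exprn_ge0 // ltW.
suff : \sum_(m <= k < n) rho ^+ k = (rho ^+ m - rho ^+ n) / (1 - rho).
  by move=> ->; rewrite ler_pM2r ?invr_gt0 // gerBl exprn_ge0.
rewrite -(subnKC mn); elim: (n - m)%N => [|j IH].
  by rewrite addn0 big_geq // subrr mul0r.
rewrite addnS big_nat_recr /= ?leq_addr // IH exprS; field.
by rewrite gt_eqF.
Qed.

Lemma series_tail_le (K : numFieldType) (f : nat -> K) (s M rho : K) (N : nat) :
  0 <= rho -> rho < 1 -> (forall n, `|f n| <= M * rho ^+ n) ->
  series f @ \oo --> s -> `|s - series f N| <= M * rho ^+ N / (1 - rho).
Proof.
move=> rho_ge0 rho_lt1 f_le fs.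
have M_ge0 : 0 <= M by have := f_le 0%N; rewrite expr0 mulr1; apply: le_trans.
apply: (@norm_lim_le _ (fun n => series f n - series f N) _ _ N).
  by apply: cvgB => //; exact: cvg_cst.
move=> n Nn; rewrite sub_series_geq //.
apply: le_trans (ler_norm_sum _ _ _) _.
apply: (@le_trans _ _ (\sum_(N <= k < n) M * rho ^+ k)).
  by apply: ler_sum => k _; exact: f_le.
by rewrite -mulr_sumr -mulrA ler_wpM2l // sum_geometric_le.
Qed.

(** Trades the factor [n] for a larger ratio; [fubini_geometric] absorbs its number of rows this
    way. *)
Lemma mulrn_exp_le (K : numFieldType) (rho sigma : K) (n : nat) :
  0 <= rho -> rho <= sigma -> sigma <= 1 ->
  n%:R * (sigma - rho) * rho ^+ n <= sigma ^+ n.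
Proof.
move=> rho_ge0 rs s1.
have s_ge0 := le_trans rho_ge0 rs.
elim: n => [|n IH]; first by rewrite !mul0r expr0.
have -> : n.+1%:R * (sigma - rho) * rho ^+ n.+1 =
   rho * (n%:R * (sigma - rho) * rho ^+ n) + (sigma - rho) * rho ^+ n.+1.
  by rewrite exprS -natr1; ring.
have -> : sigma ^+ n.+1 = rho * sigma ^+ n + (sigma - rho) * sigma ^+ n.
  by rewrite exprS; ring.
apply: lerD; first by rewrite ler_wpM2l.
rewrite ler_wpM2l ?subr_ge0 // exprS.
apply: (@le_trans _ _ (rho ^+ n)); last by rewrite lerXn2r ?nnegrE.
by rewrite ler_piMl ?exprn_ge0 // (le_trans rs).
Qed.

(** Both sides run over the pairs [(m, j)] with [m + j < N]. *)
Lemma sum_triangle (V : nmodType) (f : nat -> nat -> V) (N : nat) :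
  \sum_(0 <= n < N) \sum_(0 <= m < n.+1) f m (n - m)%N
  = \sum_(0 <= m < N) \sum_(0 <= j < N - m) f m j.
Proof.
elim: N => [|N IH]; first by rewrite !big_geq.
rewrite big_nat_recr //= IH (big_nat_recr N) //= (big_nat_recr N 0) //=.
rewrite subSn // subnn big_nat1 addrA -big_split /=; congr (_ + _).
rewrite !big_nat; apply: eq_bigr => m /andP[_ mN].
by rewrite (subSn (ltnW mN)) big_nat_recr.
Qed.

(** Row and diagonal partial sums up to [N] differ by the tails of [N] rows beyond the diagonal,
    each at most a constant times [rho ^+ N]. The difference is thus of order [N * rho ^+ N] and
    tends to 0. *)
Lemma fubini_geometric (K : numFieldType) (K_complete : geometrically_complete K)
    (f : nat -> nat -> K) (M rho : K) (F : nat -> K) :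
  0 <= rho -> rho < 1 -> (forall m j, `|f m j| <= M * rho ^+ (m + j)) ->
  (forall m, series (f m) @ \oo --> F m) ->
  exists2 s : K, series F @ \oo --> s
    & series (fun n => \sum_(0 <= m < n.+1) f m (n - m)%N) @ \oo --> s.
Proof.
move=> rho_ge0 rho_lt1 f_le fF.
have r_gt0 : 0 < 1 - rho by rewrite subr_gt0.
have M_ge0 : 0 <= M by have := f_le 0 0%N; rewrite expr0 mulr1; apply: le_trans.
have tail m j : `|F m - series (f m) j| <= M / (1 - rho) * rho ^+ (m + j).
  apply: le_trans (@series_tail_le _ _ _ (M * rho ^+ m) rho _ _ _ _ (fF m)) _ => //.
    by move=> n; rewrite -mulrA -exprD.
  suff -> : M * rho ^+ m * rho ^+ j / (1 - rho) = M / (1 - rho) * rho ^+ (m + j) by [].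
  by rewrite exprD; ring.
have F_le m : `|F m| <= M / (1 - rho) * rho ^+ m.
  by have := tail m 0; rewrite addn0 /series /= big_geq // subr0.
have /cvg_ex[s Fs] : cvgn (series F) by exact: (K_complete _ _ _ rho_ge0 rho_lt1 F_le).
exists s => //.
pose D n := \sum_(0 <= m < n.+1) f m (n - m)%N.
(* The midpoint of [rho] and 1 leaves room to absorb the factor [N]. *)
pose sigma := (1 + rho) / 2.
have rs : rho < sigma by rewrite /sigma ltr_pdivlMr // mulr_natr mulr2n ltrD2r.
have s1 : sigma < 1 by rewrite /sigma ltr_pdivrMr // mul1r -[2]/(1 + 1) ltrD2l.
have sr_gt0 : 0 < sigma - rho by rewrite subr_gt0.
have FD N : `|series F N - series D N| <= M / (1 - rho) / (sigma - rho) * sigma ^+ N.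
  rewrite /series /= /D sum_triangle -sumrB.
  apply: le_trans (ler_norm_sum _ _ _) _.
  apply: (@le_trans _ _ (\sum_(0 <= m < N) M / (1 - rho) * rho ^+ N)).
    rewrite !big_nat; apply: ler_sum => m /andP[_ mN].
    by have := tail m (N - m)%N; rewrite subnKC // ltnW.
  rewrite sumr_const_nat subn0 -[leLHS]mulr_natl -[leRHS]mulrA mulrCA.
  rewrite ler_wpM2l ?divr_ge0 ?(ltW r_gt0) // ler_pdivlMl // mulrCA mulrA.
  by rewrite mulrn_exp_le // ltW.
rewrite -[s]subr0 (_ : series _ = series F \- (fun N => series F N - series D N)); last first.
  by apply/funext => N /=; rewrite opprB addrC subrK.
apply: cvgB => //.
apply: (@cvg_dominated _ K_complete _ _ (M / (1 - rho) / (sigma - rho)) sigma).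
- by rewrite (le_trans rho_ge0) // ltW.
- by [].
- by move=> n; rewrite sub0r normrN; exact: FD.
Qed.

(** * Terminating q-series *)

Lemma qpoch0 (K : numFieldType) (q a : K) : qpoch q a 0 = 1.
Proof. by rewrite /qpoch big_ord0. Qed.

Lemma qpochSr (K : numFieldType) (q a : K) (n : nat) :
  qpoch q a n.+1 = qpoch q a n * (1 - a * q ^+ n).
Proof. by rewrite /qpoch big_ord_recr. Qed.

Lemma qpochD (K : numFieldType) (q a : K) (m n : nat) :
  qpoch q a (m + n) = qpoch q a m * qpoch q (a * q ^+ m) n.
Proof.
elim: n => [|n IH]; first by rewrite addn0 qpoch0 mulr1.
by rewrite addnS !qpochSr IH exprD !mulrA.
Qed.

Lemma qpoch1 (K : numFieldType) (q a : K) : qpoch q a 1 = 1 - a.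
Proof. by rewrite qpochSr qpoch0 mul1r expr0 mulr1. Qed.

Lemma qpochSl (K : numFieldType) (q a : K) (n : nat) :
  qpoch q a n.+1 = (1 - a) * qpoch q (a * q) n.
Proof. by rewrite -add1n qpochD qpoch1 expr1. Qed.

Lemma qpoch_neq0 (K : numFieldType) (q a : K) (n : nat) :
  (forall k, (k < n)%N -> a * q ^+ k != 1) -> qpoch q a n != 0.
Proof.
move=> h; apply/prodf_neq0 => k _.
by rewrite subr_eq0 eq_sym h.
Qed.

Lemma qpochs_nil (K : numFieldType) (q : K) (n : nat) : qpochs q [::] n = 1.
Proof. by rewrite /qpochs big_nil. Qed.

Lemma qpochs_cons (K : numFieldType) (q a : K) (s : seq K) (n : nat) :
  qpochs q (a :: s) n = qpoch q a n * qpochs q s n.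
Proof. by rewrite /qpochs big_cons. Qed.

Definition qpochsE := (qpochs_cons, qpochs_nil, mulr1).

(** Turns the factor [(q^-n)_m] of the q-Saalschütz sum into the [1 / (q)_(n-m)] of a convolution,
    ready for [n = m + j]. It is multiplied out so that the powers of [q] on either side can be
    compared without subtracting exponents. *)
Lemma qpoch_neg_exp (K : numFieldType) (q : K) (n m : nat) : q != 0 -> (m <= n)%N ->
  qpoch q (q ^- n) m * qpoch q q (n - m) * q ^+ (n * m)
  = qpoch q q n * (- 1) ^+ m * q ^+ 'C(m, 2).
Proof.
move=> q_neq0; elim: m => [|m IH] mn.
  by rewrite subn0 muln0 !qpoch0 !expr0 !mulr1 mul1r.
rewrite qpochSr; move/(_ (ltnW mn)): IH.
rewrite (_ : n - m = (n - m.+1).+1)%N; last by lia.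
rewrite qpochSr mulnS exprD binS bin1 exprD exprS.
move: (qpoch _ _ _) => X; move: (qpoch _ _ _) => Y.
move: (qpoch _ _ _) => Z IH.
have -> : Z * (-1 * (-1) ^+ m) * (q ^+ 'C(m, 2) * q ^+ m)
  = - (Z * (-1) ^+ m * q ^+ 'C(m, 2)) * q ^+ m by ring.
rewrite -IH.
have -> : q ^+ n = q * q ^+ (n - m.+1) * q ^+ m.
  by rewrite -exprS -exprD; congr (_ ^+ _); lia.
have qm : q ^+ m != 0 by rewrite expf_neq0.
have qn : q ^+ (n - m.+1) != 0 by rewrite expf_neq0.
by field; rewrite qm qn q_neq0.
Qed.

(** Both sides equal 1 at [n = 0] and satisfy the same first-order recurrence in [n]. *)
Lemma q_saalschutz (K : numFieldType) (q alpha u v : K) (n : nat) :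
  q != 0 -> u != 0 -> v != 0 ->
  (forall k : nat, q ^+ k.+1 != 1) -> alpha != 1 ->
  (forall k : nat, alpha * u * q ^+ k != 1) ->
  (forall k : nat, alpha * v * q ^+ k != 1) ->
  \sum_(0 <= m < n.+1)
     qpochs q [:: q ^- n; alpha * q ^+ n; alpha * u * v / q] m * q ^+ m
     / qpochs q [:: q; alpha * u; alpha * v] m
  = qpochs q [:: q / u; q / v] n * (alpha * u * v / q) ^+ n
    / qpochs q [:: alpha * u; alpha * v] n.
Proof.
move=> q0 u0 v0 hq ha hu hv.
have hq' k : qpoch q q k != 0 by apply: qpoch_neq0 => j _; rewrite -exprS.
have hu' k : qpoch q (alpha * u) k != 0 by apply: qpoch_neq0.
have hv' k : qpoch q (alpha * v) k != 0 by apply: qpoch_neq0.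
pose P := alpha * u * v / q.
pose s n m := qpochs q [:: q ^- n; alpha * q ^+ n; P] m * q ^+ m
     / qpochs q [:: q; alpha * u; alpha * v] m.
rewrite -/P -/(s n).
(* [Y N / X N] is the ratio of consecutive values of the right-hand side. *)
pose X N := (1 - alpha * u * q ^+ N) * (1 - alpha * v * q ^+ N).
pose Y N := (u - q ^+ N.+1) * (v - q ^+ N.+1) * alpha / q.
(* The recurrence in [N] is obtained by creative telescoping; the right-hand
   side is the Wilf-Zeilberger antidifference. *)
have step N m :
  \sum_(0 <= i < m.+1) (s N.+1 i * X N - s N i * Y N)
  = (1 - alpha * q ^+ N * q ^+ N.+1)
    * qpoch q (q ^- N) m * qpoch q (alpha * q ^+ N.+1) m * qpoch q P m.+1
    / (qpochs q [:: q; alpha * u; alpha * v] m).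
  rewrite /X /Y /s; elim: m => [|m IH].
    rewrite big_nat1 !qpochsE !qpoch0 !qpoch1 !exprS /P.
    by field.
  rewrite big_nat_recr //= {}IH !qpochsE.
  rewrite (qpochSl q (q ^- N.+1)) (qpochSr q P m.+1) (qpochSr q (alpha * q ^+ N.+1) m).
  rewrite (qpochSl q (alpha * q ^+ N)) (qpochSr q (q ^- N) m).
  rewrite -[alpha * q ^+ N * q]mulrA -exprSr.
  rewrite (_ : q ^- N.+1 * q = q ^- N); last first.
    by rewrite exprS invfM mulrAC mulVf // mul1r.
  rewrite !(qpochSr q _ m).
  move: (hq' m.+1) (hu' m.+1) (hv' m.+1); rewrite !qpochSr !mulf_eq0 !negb_or.
  move=> /andP[d1 d1'] /andP[d2 d2'] /andP[d3 d3'].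
  move: d1' d2' d3'; rewrite !exprS.
  have QN0 : q ^+ N != 0 by rewrite expf_neq0.
  move: (qpoch _ _ _) d1 => A1 d1; move: (qpoch _ _ _) d2 => A2 d2.
  move: (qpoch _ _ _) d3 => A3 d3.
  move: (qpoch _ _ _) (qpoch _ _ _) (qpoch _ _ _) => B1 B2 B3.
  rewrite /P; move: (q ^+ N) QN0 (q ^+ m) => Q Q0 M d1' d2' d3'.
  by field; rewrite q0 d1 d1' d2 d2' d3 d3' Q0.
have rec N : \sum_(0 <= m < N.+2) s N.+1 m * X N = \sum_(0 <= m < N.+1) s N m * Y N.
  (* The term [s N N.+1] contains [(q^-N)_(N+1) = 0], so both sums can run to the same end, where
     the antidifference vanishes for the same reason. *)
  have -> : \sum_(0 <= m < N.+1) s N m * Y N = \sum_(0 <= m < N.+2) s N m * Y N.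
    rewrite [RHS]big_nat_recr //= [s N N.+1](_ : _ = 0) ?mul0r ?addr0 //.
    by rewrite /s !qpochsE qpochSr mulVf ?expf_neq0 // subrr mulr0 !mul0r.
  apply/eqP; rewrite -subr_eq0 -sumrB step (qpochSr q (q ^- N)).
  by rewrite mulVf ?expf_neq0 // subrr !(mulr0, mul0r).
elim: n => [|N IH].
  by rewrite big_nat1 /s !qpochsE !qpoch0 ?expr0 ?mulr1.
have X0 : X N != 0 by rewrite mulf_neq0 // subr_eq0 eq_sym.
apply: (mulIf X0); rewrite mulr_suml rec -mulr_suml IH.
rewrite !qpochsE !(qpochSr _ _ N) exprS /X /Y.
move: (hu' N.+1) (hv' N.+1); rewrite !qpochSr !mulf_eq0 !negb_or.
move=> /andP[d2 d2'] /andP[d3 d3'].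
by rewrite /P exprS; field; rewrite q0 u0 v0 d2 d2' d3 d3'.
Qed.

(** As [D * w] and [E * w] play the roles of [alpha q / E] and [alpha q / D], this is the
    terminating very-well-poised 6phi5 sum, written as the defining relation of a Bailey pair
    relative to [alpha]. *)
Lemma bailey_pair_wp (K : numFieldType) (q alpha D E w : K) (n : nat) :
  q != 0 -> D * E * w = alpha * q -> alpha != 1 ->
  (forall k : nat, q ^+ k.+1 != 1) ->
  (forall k : nat, alpha * q * q ^+ k != 1) ->
  (forall k : nat, D * w * q ^+ k != 1) ->
  (forall k : nat, E * w * q ^+ k != 1) ->
  \sum_(0 <= k < n.+1)
     (1 - alpha * q ^+ (2 * k)) / (1 - alpha)
     * qpochs q [:: alpha; D; E] k / qpochs q [:: q; D * w; E * w] k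
     * (- w) ^+ k * q ^+ 'C(k, 2)
     / (qpoch q q (n - k) * qpoch q (alpha * q) (n + k))
  = qpoch q w n / qpochs q [:: q; D * w; E * w] n.
Proof.
move=> q0 DEw ha hq haq hD hE.
have hq' k : qpoch q q k != 0 by apply: qpoch_neq0 => j _; rewrite -exprS.
have haq' k : qpoch q (alpha * q) k != 0 by apply: qpoch_neq0.
have hD' k : qpoch q (D * w) k != 0 by apply: qpoch_neq0.
have hE' k : qpoch q (E * w) k != 0 by apply: qpoch_neq0.
have a1 : 1 - alpha != 0 by rewrite subr_eq0 eq_sym.
pose c k := (1 - alpha * q ^+ (2 * k)) / (1 - alpha)
     * qpochs q [:: alpha; D; E] k / qpochs q [:: q; D * w; E * w] k
     * (- w) ^+ k * q ^+ 'C(k, 2).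
pose s n k := c k / (qpoch q q (n - k) * qpoch q (alpha * q) (n + k)).
rewrite -/(s n).
(* Again [Y N / X N] is the ratio of consecutive values of the right-hand side. *)
pose X N := (1 - q ^+ N.+1) * (1 - D * w * q ^+ N) * (1 - E * w * q ^+ N).
pose Y N := 1 - w * q ^+ N.
(* Creative telescoping in [N], as for the q-Saalschütz sum. *)
have step N m : (m <= N)%N ->
  \sum_(0 <= k < m.+1) (s N.+1 k * X N - s N k * Y N)
  = q ^+ N * qpoch q (alpha * q) m * qpoch q D m.+1 * qpoch q E m.+1
    * (- w) ^+ m * w * q ^+ 'C(m, 2)
    / (qpochs q [:: q; D * w; E * w] m
       * qpoch q q (N - m) * qpoch q (alpha * q) (N + m).+1).
  elim: m => [_|m IH mN].
    rewrite big_nat1 /s /c !subn0 !addn0 muln0 !qpochsE !qpoch0 !qpoch1 /X /Y.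
    move: (hq' N.+1) (haq' N.+1); rewrite !qpochSr !mulf_eq0 !negb_or !exprS.
    move=> /andP[d1 d1'] /andP[d2 d2'].
    rewrite ?expr0.
    by field: DEw; rewrite d1 d1' d2 d2' a1.
  rewrite big_nat_recr //= {}IH ?(ltnW mN) // /s /c subSS /X /Y.
  rewrite !qpochsE (qpochSl q alpha) !addSn addnS.
  rewrite (_ : N - m = (N - m.+1).+1)%N; last by lia.
  rewrite binS bin1 exprD mulnC exprM.
  move: (hq' m.+1) (hD' m.+1) (hE' m.+1) (haq' (N + m).+2) (hq' (N - m.+1).+1).
  rewrite !qpochSr !mulf_eq0 !negb_or.
  move=> /andP[d1 d1'] /andP[d2 d2'] /andP[d3 d3'] /andP[/andP[d4 d4'] d4''].
  move=> /andP[d5 d5']; move: d1' d2' d3' d4' d4'' d5'.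
  rewrite (_ : q ^+ N.+1 = q * q ^+ N); last by rewrite exprS.
  rewrite (_ : q ^+ (N + m).+1 = q * q ^+ N * q ^+ m); last by rewrite exprS exprD mulrA.
  rewrite exprD (_ : q ^+ N = q ^+ (N - m.+1) * q * q ^+ m); last first.
    by rewrite -exprSr -exprD; congr (_ ^+ _); lia.
  rewrite !exprS expr0.
  move: (qpoch _ _ _) d1 => A1 d1; move: (qpoch _ _ _) d2 => A2 d2.
  move: (qpoch _ _ _) d3 => A3 d3; move: (qpoch _ _ _) d4 => A4 d4.
  move: (qpoch _ _ _) d5 => A5 d5.
  move: (qpoch _ _ _) (qpoch _ _ _) (qpoch _ _ _) => B1 B2 B3.
  move: (q ^+ (N - _)) (q ^+ m) (q ^+ 'C(m, 2)) ((- w) ^+ m) => r M Z W.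
  move=> d1' d2' d3' d4' d4'' d5'.
  by field: DEw; rewrite d1 d1' d2 d2' d3 d3' d4 d4' d4'' d5 d5' a1.
(* With truncated subtraction [1 / (q)_(N-k)] does not vanish at [k = N + 1], so the shorter sum
   cannot be extended; the extra term is computed apart and cancels the antidifference at
   [m = N]. *)
have top N : s N.+1 N.+1 * X N =
  - (q ^+ N * qpoch q (alpha * q) N * qpoch q D N.+1 * qpoch q E N.+1
    * (- w) ^+ N * w * q ^+ 'C(N, 2)
    / (qpochs q [:: q; D * w; E * w] N * qpoch q (alpha * q) (N + N).+1)).
  rewrite /s /c /X subnn qpoch0 !qpochsE (qpochSl q alpha) addSn addnS.
  rewrite binS bin1 exprD.
  move: (hq' N.+1) (hD' N.+1) (hE' N.+1) (haq' (N + N).+2).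
  rewrite !qpochSr !mulf_eq0 !negb_or.
  move=> /andP[d1 d1'] /andP[d2 d2'] /andP[d3 d3'] /andP[/andP[d4 d4'] d4''].
  move: d1' d2' d3' d4' d4''.
  rewrite (_ : q ^+ (N + N).+1 = q * q ^+ N * q ^+ N); last by rewrite exprS exprD mulrA.
  rewrite (_ : q ^+ (2 * N.+1) = q * q * q ^+ N * q ^+ N); last first.
    by rewrite mulnS mul2n -addnn !exprD; ring.
  rewrite exprD !exprS.
  move: (qpoch _ _ _) d1 => A1 d1; move: (qpoch _ _ _) d2 => A2 d2.
  move: (qpoch _ _ _) d3 => A3 d3; move: (qpoch _ _ _) d4 => A4 d4.
  move: (qpoch _ _ _) (qpoch _ _ _) (qpoch _ _ _) => B1 B2 B3.
  move=> d1' d2' d3' d4' d4''.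
  by field; rewrite d1 d1' d2 d2' d3 d3' d4 d4' d4'' a1.
have rec N : \sum_(0 <= k < N.+2) s N.+1 k * X N = \sum_(0 <= k < N.+1) s N k * Y N.
  apply/eqP; rewrite -subr_eq0 big_nat_recr //= addrAC -sumrB step // top.
  by rewrite subnn qpoch0 mulr1 subrr.
elim: n => [|N IH].
  rewrite big_nat1 /s /c !qpochsE !qpoch0 ?muln0 ?expr0 ?mulr1 ?divr1 ?invr1.
  by field.
have := hq' N.+1; have := hD' N.+1; have := hE' N.+1.
rewrite !qpochSr !mulf_eq0 !negb_or -exprS.
move=> /andP[d3 d3'] /andP[d2 d2'] /andP[d1 d1'].
have X0 : X N != 0 by rewrite /X !mulf_neq0.
apply: (mulIf X0); rewrite mulr_suml rec -mulr_suml IH /X /Y.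
rewrite !qpochsE !(qpochSr _ _ N) -exprS.
by field; rewrite d2 d2' d3 d3' d1 d1'.
Qed.

(** * Infinite products and the q-Gauss sum *)

(** Weierstrass product inequalities: with [S n] the sum of the norms of the [a q^k], induction
    gives [1 - S n] as a lower bound and its inverse as an upper bound. The threshold on [a] makes
    [S n] at most 1/2. *)
Lemma qpoch_small_bounds (K : numFieldType) (q a : K) (n : nat) :
  0 < q -> q < 1 -> `|a| <= (1 - q) / 2 ->
  2^-1 <= `|qpoch q a n| /\ `|qpoch q a n| <= 2.
Proof.
move=> q_gt0 q_lt1 a_le; set x := `|a| in a_le.
have q1 : 0 < 1 - q by rewrite subr_gt0.
have x_ge0 : 0 <= x := normr_ge0 a.
pose S n := x * \sum_(0 <= k < n) q ^+ k.
have S_ge0 k : 0 <= S k.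
  by rewrite mulr_ge0 // sumr_ge0 // => i _; rewrite exprn_ge0 // ltW.
have S_le k : S k <= 2^-1.
  have := sum_geometric_le 0 k (ltW q_gt0) q_lt1; rewrite expr0 div1r => h.
  apply: le_trans (ler_wpM2l x_ge0 h) _.
  by rewrite ler_pdivrMr // mulrC.
have SS k : S k.+1 = S k + x * q ^+ k by rewrite /S big_nat_recr //= mulrDr.
have half : 1 - 2^-1 = 2^-1 :> K by field.
have S1 k : 2^-1 <= 1 - S k by rewrite -[leLHS]half lerD2l lerN2.
have S1_ge0 k : 0 <= 1 - S k by apply: le_trans (S1 k); rewrite invr_ge0.
have xq k : 0 <= x * q ^+ k by rewrite mulr_ge0 // exprn_ge0 // ltW.
have nx k : `|a * q ^+ k| = x * q ^+ k.
  by rewrite normrM normrX (gtr0_norm q_gt0).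
have low : 1 - S n <= `|qpoch q a n|.
  elim: n => [|k IH]; first by rewrite /S big_geq // mulr0 subr0 qpoch0 normr1.
  rewrite qpochSr normrM SS.
  apply: (@le_trans _ _ ((1 - S k) * (1 - x * q ^+ k))).
    rewrite -subr_ge0 (_ : _ - _ = S k * (x * q ^+ k)); last by ring.
    by rewrite mulr_ge0.
  apply: le_trans (ler_wpM2l (S1_ge0 k) _) (ler_wpM2r (normr_ge0 _) IH).
  by apply: le_trans (lerB_dist _ _); rewrite normr1 nx.
have up : `|qpoch q a n| * (1 - S n) <= 1.
  elim: n {low} => [|k IH].
    by rewrite /S big_geq // mulr0 subr0 qpoch0 normr1 mulr1.
  rewrite qpochSr normrM; apply: le_trans _ IH; rewrite -mulrA ler_wpM2l //.
  apply: (@le_trans _ _ ((1 + x * q ^+ k) * (1 - S k.+1))).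
    rewrite ler_wpM2r //; apply: le_trans (ler_normB _ _) _.
    by rewrite normr1 nx.
  rewrite SS -subr_ge0.
  rewrite (_ : _ - _ = x * q ^+ k * S k + (x * q ^+ k) ^+ 2); last by ring.
  by rewrite addr_ge0 ?exprn_ge0 // mulr_ge0.
split; first exact: le_trans (S1 n) low.
have : `|qpoch q a n| * 2^-1 <= 1 by apply: le_trans up; rewrite ler_wpM2l.
by rewrite ler_pdivrMr // mul1r.
Qed.

(** Enough shifts by [q] bring any [a] under the threshold of [qpoch_small_bounds]; the property is
    then carried back one factor at a time. *)
Lemma q_shift_ind (K : numFieldType) (K_complete : geometrically_complete K)
    (q : K) (P : K -> Prop) : 0 < q -> q < 1 ->
  (forall a, `|a| <= (1 - q) / 2 -> P a) -> (forall a, P (a * q) -> P a) ->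
  forall a, P a.
Proof.
move=> q_gt0 q_lt1 P_small P_shift a.
have [N aN] : exists N, `|a * q ^+ N| <= (1 - q) / 2.
  have /cvgrPdist_lt := cvg_exp0 K_complete (ltW q_gt0) q_lt1.
  have a1 : 0 < `|a| + 1 by rewrite ltr_wpDl.
  move=> /(_ ((1 - q) / 2 / (`|a| + 1))).
  rewrite !divr_gt0 ?subr_gt0 // => /(_ isT) near_q.
  near \oo => N; exists N.
  have : `|0 - q ^+ N| < (1 - q) / 2 / (`|a| + 1) by near: N.
  rewrite sub0r normrN ltr_pdivlMr // mulrC => /ltW; apply: le_trans.
  by rewrite normrM ler_wpM2r // lerDl.
elim: N a aN => [|N IH] a; first by rewrite expr0 mulr1; exact: P_small.
by rewrite exprS mulrA => /IH /P_shift.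
Unshelve. all: by end_near.
Qed.

Lemma qpoch_bounded (K : numFieldType) (K_complete : geometrically_complete K)
    (q a : K) : 0 < q -> q < 1 ->
  exists2 M : K, 0 <= M & forall m n, `|qpoch q (a * q ^+ m) n| <= M.
Proof.
move=> q_gt0 q_lt1; move: a; apply: (q_shift_ind K_complete q_gt0 q_lt1) => a.
  move=> a_le; exists 2 => // m n.
  have [] // := @qpoch_small_bounds _ q (a * q ^+ m) n q_gt0 q_lt1.
  apply: le_trans a_le; rewrite normrM ler_piMr // normrX gtr0_norm //.
  by rewrite exprn_ile1 // ltW.
(* The three summands cover [n = 0], a shift [m > 0], and [m = 0] with the factor [1 - a] split
   off. *)
case=> M M_ge0 aqM; exists (1 + M + `|1 - a| * M).
  by rewrite !addr_ge0 ?mulr_ge0.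
have le1 : 1 <= 1 + M + `|1 - a| * M by rewrite -addrA lerDl addr_ge0 ?mulr_ge0.
have leM : M <= 1 + M + `|1 - a| * M.
  by rewrite -addrA addrCA lerDl addr_ge0 ?mulr_ge0.
move=> [|m] [|n]; rewrite ?qpoch0 ?normr1 //.
  rewrite expr0 mulr1 qpochSl normrM; have := aqM 0 n; rewrite expr0 mulr1 => h.
  by rewrite (le_trans (ler_wpM2l _ h)) // lerDr addr_ge0.
by rewrite exprS mulrA (le_trans (aqM _ _)).
Qed.

(** Uniformity in the shift [m] serves [q_gauss], where the lower parameter moves with the
    iteration. *)
Lemma qpochV_bounded (K : numFieldType) (K_complete : geometrically_complete K)
    (q a : K) : 0 < q -> q < 1 -> (forall k, a * q ^+ k != 1) ->
  exists2 M : K, 0 <= M & forall m n, `|(qpoch q (a * q ^+ m) n)^-1| <= M.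
Proof.
move=> q_gt0 q_lt1; move: a; apply: (q_shift_ind K_complete q_gt0 q_lt1) => a.
  move=> a_le _; exists 2 => // m n.
  have [] // := @qpoch_small_bounds _ q (a * q ^+ m) n q_gt0 q_lt1.
    apply: le_trans a_le; rewrite normrM ler_piMr // normrX gtr0_norm //.
    by rewrite exprn_ile1 // ltW.
  move=> h _; have p_gt0 : 0 < `|qpoch q (a * q ^+ m) n|.
    by apply: lt_le_trans h; rewrite invr_gt0.
  by rewrite normfV -[leRHS]invrK lef_pV2 ?posrE ?invr_gt0.
move=> IH a_neq1; case: IH => [k|M M_ge0 aqM].
  by rewrite -mulrA -exprS.
pose L := `|(1 - a)^-1|; have L_ge0 : 0 <= L := normr_ge0 _; exists (1 + M + L * M).
  by rewrite !addr_ge0 ?mulr_ge0.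
have le1 : 1 <= 1 + M + L * M by rewrite -addrA lerDl addr_ge0 ?mulr_ge0.
have leM : M <= 1 + M + L * M by rewrite -addrA addrCA lerDl addr_ge0 ?mulr_ge0.
move=> [|m] [|n]; rewrite ?qpoch0 ?invr1 ?normr1 //.
  rewrite expr0 mulr1 qpochSl invfM normrM; have := aqM 0 n.
  rewrite expr0 mulr1 => h.
  by rewrite (le_trans (ler_wpM2l _ h)) // lerDr addr_ge0.
by rewrite exprS mulrA (le_trans (aqM _ _)).
Qed.

(** [(a)_n] is 1 plus a partial sum of the differences [- a q^k (a)_k], which decay geometrically
    because [(a)_k] is bounded. *)
Lemma cvg_qpoch (K : numFieldType) (K_complete : geometrically_complete K)
    (q a : K) : 0 < q -> q < 1 -> qpoch q a @ \oo --> qpoch_inf q a.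
Proof.
move=> q_gt0 q_lt1; suff : cvgn (qpoch q a) by [].
have [M M_ge0 aM] := qpoch_bounded K_complete a q_gt0 q_lt1.
pose f k := - (a * q ^+ k) * qpoch q a k.
have f_le k : `|f k| <= `|a| * M * q ^+ k.
  have := aM 0%N k; rewrite expr0 mulr1 => h.
  rewrite normrM normrN normrM normrX (gtr0_norm q_gt0) mulrAC.
  by rewrite ler_wpM2r ?exprn_ge0 ?(ltW q_gt0) // ler_wpM2l.
have /cvg_ex[l fl] := K_complete _ _ _ (ltW q_gt0) q_lt1 f_le.
apply/cvg_ex; exists (1 + l).
rewrite (_ : qpoch q a = (fun n => 1 + series f n)); last first.
  apply/funext; elim=> [|n IH]; first by rewrite qpoch0 /series /= big_geq // addr0.
  by rewrite seriesSr addrA -IH qpochSr /f; ring.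
by apply: cvgD => //; exact: cvg_cst.
Qed.

(** Bounded reciprocals keep the partial products away from 0. *)
Lemma qpoch_inf_neq0 (K : numFieldType) (K_complete : geometrically_complete K)
    (q a : K) : 0 < q -> q < 1 -> (forall k, a * q ^+ k != 1) ->
  qpoch_inf q a != 0.
Proof.
move=> q_gt0 q_lt1 a_neq1.
have [M M_ge0 aM] := qpochV_bounded K_complete q_gt0 q_lt1 a_neq1.
apply/eqP => a0; have := @cvg_qpoch _ K_complete q a q_gt0 q_lt1.
rewrite a0 => /cvgrPdist_lt /(_ (M + 1)^-1).
have M1 : 0 < M + 1 by rewrite ltr_wpDl.
rewrite invr_gt0 => /(_ M1) near_p; near \oo => n.
have : `|0 - qpoch q a n| < (M + 1)^-1 by near: n.
rewrite sub0r normrN => h.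
have p0 : qpoch q a n != 0 by apply: qpoch_neq0.
have := aM 0 n; rewrite expr0 mulr1 normfV => h2.
have : M + 1 < M.
  by apply: lt_le_trans h2; rewrite -[ltLHS]invrK ltf_pV2 ?posrE ?invr_gt0 ?normr_gt0.
by rewrite gtrDl ltr10.
Unshelve. all: by end_near.
Qed.

Lemma cvg_uniq (K : numFieldType) (u : nat -> K) (x y : K) :
  u @ \oo --> x -> u @ \oo --> y -> x = y.
Proof. exact: (@cvg_unique K (@norm_hausdorff K K)). Qed.

Lemma qpoch_inf_shift (K : numFieldType) (K_complete : geometrically_complete K)
    (q a : K) (m : nat) : 0 < q -> q < 1 ->
  qpoch_inf q a = qpoch q a m * qpoch_inf q (a * q ^+ m).
Proof.
move=> q_gt0 q_lt1; apply: (@cvg_uniq _ (fun n => qpoch q a (n + m))).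
  by have := @cvg_qpoch _ K_complete q a q_gt0 q_lt1; rewrite -(cvg_shiftn m).
under eq_fun do rewrite addnC qpochD.
by apply: cvgM; [exact: cvg_cst | exact: cvg_qpoch].
Qed.

Lemma mulrX_neq1 (K : numFieldType) (q a : K) (k : nat) :
  0 < q -> q < 1 -> `|a| < 1 -> a * q ^+ k != 1.
Proof.
move=> q_gt0 q_lt1 a_lt1; apply/eqP => h.
have : `|a * q ^+ k| < 1.
  apply: le_lt_trans a_lt1.
  rewrite normrM ler_piMr // normrX gtr0_norm // exprn_ile1 //; exact: ltW.
by rewrite h normr1 ltxx.
Qed.

(* Iterating [t |-> t q] drives the q-Gauss sum to its value [1] at [t = 0]. *)
Lemma gauss_recurrence (K : numFieldType) (K_complete : geometrically_complete K)
    (q x y t s0 s1 : K) : 0 < q -> q < 1 -> `|x * y * t| < 1 ->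
  let T t n := qpochs q [:: x; y] n / qpochs q [:: q; x * y * t] n * t ^+ n in
  series (T t) @ \oo --> s0 -> series (T (t * q)) @ \oo --> s1 ->
  s0 * ((1 - t) * (1 - x * y * t)) = (1 - x * t) * (1 - y * t) * s1.
Proof.
move=> q_gt0 q_lt1 xyt T Ts0 Ts1.
have nz k := mulrX_neq1 k q_gt0 q_lt1 xyt.
have hq' k : qpoch q q k != 0.
  by apply: qpoch_neq0 => j _; rewrite mulrX_neq1 // gtr0_norm.
have hz k : qpoch q (x * y * t) k != 0 by apply: qpoch_neq0.
have hzq k : qpoch q (x * y * t * q) k != 0.
  by have := hz k.+1; rewrite qpochSl mulf_eq0 negb_or => /andP[].
have z1 : 1 - x * y * t != 0 by have := hz 1; rewrite qpoch1.
(* For partial sums the recurrence holds up to a multiple of the first omitted term [T t n], which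
   tends to 0. *)
have tele n : (1 - t) * (1 - x * y * t) * series (T t) n
    - (1 - x * t) * (1 - y * t) * series (T (t * q)) n
    = - ((1 - x * y * t) * ((1 - q ^+ n) * T t n)).
  elim: n => [|n IH].
    by rewrite /series /= !big_geq // expr0 subrr !(mulr0, mul0r) subrr oppr0.
  rewrite !seriesSr [X in X - _]mulrDr [X in _ - X]mulrDr opprD addrACA {}IH.
  rewrite /T !qpochsE [x * y * (t * q)]mulrA.
  have -> : qpoch q (x * y * t * q) n
      = qpoch q (x * y * t) n * (1 - x * y * t * q ^+ n) / (1 - x * y * t).
    by rewrite -qpochSr qpochSl [RHS]mulrC mulKf.
  have := hq' n.+1; have := hz n.+1.
  rewrite !qpochSr !mulf_eq0 !negb_or exprMn !exprS.
  move=> /andP[d1 d1'] /andP[d2 d2'].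
  by field; rewrite d1 d1' d2 d2' z1.
have T0 : T t @ \oo --> (0 : K) by apply: cvg_series_cvg_0; apply: cvgP Ts0.
have q0 := cvg_exp0 K_complete (ltW q_gt0) q_lt1.
apply/eqP; rewrite -subr_eq0; apply/eqP.
apply: (@cvg_uniq _ (fun n => - ((1 - x * y * t) * ((1 - q ^+ n) * T t n)))).
  rewrite [s0 * _]mulrC; under eq_fun do rewrite -tele.
  by apply: cvgB; apply: cvgM => //; exact: cvg_cst.
suff : (fun n => - ((1 - x * y * t) * ((1 - q ^+ n) * T t n))) @ \oo
    --> - ((1 - x * y * t) * ((1 - 0) * 0)) by rewrite !mulr0 oppr0.
apply: cvgN; apply: cvgM; first exact: cvg_cst.
by apply: cvgM => //; apply: cvgB => //; exact: cvg_cst.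
Qed.

(** Taking [t] as a parameter, with lower parameter [x * y * t], avoids the usual quotient by
    [x * y], so that [x] and [y] may be 0. *)
Lemma q_gauss (K : numFieldType) (K_complete : geometrically_complete K)
    (q x y t : K) : 0 < q -> q < 1 -> `|t| < 1 -> `|x * y * t| < 1 ->
  series (fun n => qpochs q [:: x; y] n / qpochs q [:: q; x * y * t] n * t ^+ n)
    @ \oo --> qpochs_inf q [:: x * t; y * t] / qpochs_inf q [:: t; x * y * t].
Proof.
move=> q_gt0 q_lt1 t_lt1 xyt.
have q_ge0 := ltW q_gt0.
pose T t n := qpochs q [:: x; y] n / qpochs q [:: q; x * y * t] n * t ^+ n.
rewrite -/(T t).
have nz k := mulrX_neq1 k q_gt0 q_lt1 xyt.
have nt k := mulrX_neq1 k q_gt0 q_lt1 t_lt1.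
have nq k : q * q ^+ k != 1 by rewrite mulrX_neq1 // gtr0_norm.
have [Mx Mx0 hx] := qpoch_bounded K_complete x q_gt0 q_lt1.
have [My My0 hy] := qpoch_bounded K_complete y q_gt0 q_lt1.
have [Mq Mq0 hq] := qpochV_bounded K_complete q_gt0 q_lt1 nq.
have [Mz Mz0 hz] := qpochV_bounded K_complete q_gt0 q_lt1 nz.
pose M := Mx * My * (Mq * Mz).
have M0 : 0 <= M by rewrite !mulr_ge0.
have tN N : `|t * q ^+ N| = `|t| * q ^+ N by rewrite normrM normrX (gtr0_norm q_gt0).
have tN_le N : `|t| * q ^+ N <= `|t| by rewrite ler_piMr // exprn_ile1 // ltW.
have T_le N n : `|T (t * q ^+ N) n| <= M * (`|t| * q ^+ N) ^+ n.
  rewrite /T !qpochsE normrM normrX tN ler_wpM2r ?exprn_ge0 ?mulr_ge0 ?exprn_ge0 //.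
  rewrite invfM !normrM.
  have := hx 0 n; have := hy 0 n; have := hq 0 n; have := hz N n.
  rewrite !expr0 !mulr1 -mulrA => ? ? ? ?.
  by rewrite !(mulr_ge0, ler_pM, normr_ge0).
have s_ex N : exists s : K, series (T (t * q ^+ N)) @ \oo --> s.
  suff : cvgn (series (T (t * q ^+ N))) by exists (limn (series (T (t * q ^+ N)))).
  apply: (K_complete _ _ _ _ _ (T_le N)).
    by rewrite mulr_ge0 ?exprn_ge0.
  exact: le_lt_trans (tN_le N) t_lt1.
have [s sE] := choice s_ex.
have rec N : s 0 * (qpoch q t N * qpoch q (x * y * t) N)
    = qpoch q (x * t) N * qpoch q (y * t) N * s N.
  elim: N => [|N IH]; first by rewrite !qpoch0 !mulr1 mul1r.
  have := @gauss_recurrence _ K_complete q x y (t * q ^+ N) (s N) (s N.+1) q_gt0 q_lt1.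
  have h : `|x * y * (t * q ^+ N)| < 1.
    by rewrite mulrA (le_lt_trans _ xyt) // normrM normrX (gtr0_norm q_gt0)
      ler_piMr // exprn_ile1 // ltW.
  move=> /(_ h (sE N)); rewrite -[t * _ * q]mulrA -exprSr => /(_ (sE N.+1)) gr.
  rewrite !qpochSr.
  transitivity (s 0 * (qpoch q t N * qpoch q (x * y * t) N)
     * ((1 - t * q ^+ N) * (1 - x * y * (t * q ^+ N)))); first by ring.
  rewrite IH -mulrA gr; ring.
(* The term of index 0 is 1; the others together are at most a constant times [q ^+ N], because [M]
   in [T_le] does not depend on [N]. *)
have s1 : s @ \oo --> (1 : K).
  have t1 : 0 < 1 - `|t| by rewrite subr_gt0.
  apply: (@cvg_dominated _ K_complete _ _ (M * `|t| / (1 - `|t|)) q) => // N.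
  have := @series_tail_le _ _ _ _ _ 1 _ _ (T_le N) (sE N).
  have -> : series (T (t * q ^+ N)) 1 = 1.
    by rewrite /series /= big_nat1 /T !qpochsE !qpoch0 ?expr0 ?mulr1 ?divr1.
  rewrite distrC.
  move=> h; apply: le_trans (h _ _) _.
  - by rewrite mulr_ge0 ?exprn_ge0.
  - exact: le_lt_trans (tN_le N) t_lt1.
  rewrite -[leRHS]mulrA [leRHS]mulrCA [_^-1 * _]mulrC expr1 !mulrA.
  rewrite -!mulrA !ler_wpM2l ?exprn_ge0 //.
  by rewrite lef_pV2 ?posrE ?lerD2l ?lerN2 // subr_gt0 (le_lt_trans (tN_le N)).
have D0 : qpochs_inf q [:: t; x * y * t] != 0.
  by rewrite /qpochs_inf !big_cons big_nil mulr1 mulf_neq0 // qpoch_inf_neq0.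
have -> : qpochs_inf q [:: x * t; y * t] / qpochs_inf q [:: t; x * y * t] = s 0.
  apply: (canLR (mulfK D0)).
  rewrite /qpochs_inf !big_cons !big_nil !mulr1; symmetry.
  (* The product formula is the limit of [rec] as [N] tends to infinity. *)
  apply: (@cvg_uniq _ (fun N => s 0 * (qpoch q t N * qpoch q (x * y * t) N))).
    by apply: cvgM; [exact: cvg_cst | apply: cvgM; exact: cvg_qpoch].
  under eq_fun do rewrite rec; rewrite -[qpoch_inf q (x * t) * _]mulr1.
  by apply: cvgM => //; apply: cvgM; exact: cvg_qpoch.
by have := sE 0; rewrite expr0 mulr1.
Qed.

(** * Double sums *)

(** Allows the summand of a double series to be bounded factor by factor, without explicit
    constants. *)
Definition norm_bounded (I : Type) (K : numFieldType) (f : I -> K) : Prop :=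
  exists2 M : K, 0 <= M & forall i, `|f i| <= M.

Lemma norm_bounded_cst (I : Type) (K : numFieldType) (c : K) :
  norm_bounded (fun _ : I => c).
Proof. by exists `|c|. Qed.

Lemma norm_boundedM (I : Type) (K : numFieldType) (f g : I -> K) :
  norm_bounded f -> norm_bounded g -> norm_bounded (fun i => f i * g i).
Proof.
move=> [M M0 fM] [N N0 gN]; exists (M * N); first exact: mulr_ge0.
by move=> i; rewrite normrM ler_pM.
Qed.

Lemma norm_boundedB (I : Type) (K : numFieldType) (f g : I -> K) :
  norm_bounded f -> norm_bounded g -> norm_bounded (fun i => f i - g i).
Proof.
move=> [M M0 fM] [N N0 gN]; exists (M + N); first exact: addr_ge0.
by move=> i; apply: le_trans (ler_normB _ _) _; apply: lerD.
Qed.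

Lemma norm_boundedX (I : Type) (K : numFieldType) (x : K) (e : I -> nat) :
  `|x| <= 1 -> norm_bounded (fun i => x ^+ e i).
Proof. by move=> x1; exists 1 => // i; rewrite normrX exprn_ile1. Qed.

Lemma norm_bounded_qpoch (I : Type) (K : numFieldType)
    (K_complete : geometrically_complete K) (q a : K) (e : I -> nat) :
  0 < q -> q < 1 -> norm_bounded (fun i => qpoch q a (e i)).
Proof.
move=> q_gt0 q_lt1; have [M M0 h] := qpoch_bounded K_complete a q_gt0 q_lt1.
by exists M => // i; have := h 0%N (e i); rewrite expr0 mulr1.
Qed.

Lemma norm_bounded_qpochV (I : Type) (K : numFieldType)
    (K_complete : geometrically_complete K) (q a : K) (e : I -> nat) :
  0 < q -> q < 1 -> (forall k, a * q ^+ k != 1) ->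
  norm_bounded (fun i => (qpoch q a (e i))^-1).
Proof.
move=> q_gt0 q_lt1 a1; have [M M0 h] := qpochV_bounded K_complete q_gt0 q_lt1 a1.
by exists M => // i; have := h 0%N (e i); rewrite expr0 mulr1.
Qed.

Lemma cvg_seriesZl (K : numFieldType) (f : nat -> K) (c s : K) :
  series f @ \oo --> s -> series (fun n => c * f n) @ \oo --> c * s.
Proof.
move=> fs; rewrite (_ : series _ = fun n => c * series f n).
  by apply: cvgM => //; exact: cvg_cst.
by apply/funext => n; rewrite /series /= mulr_sumr.
Qed.

(** When [B C t = D E w = alpha q], each lower parameter is [alpha q] over an upper one: this is the
    very-well-poised 8phi7 summand with one parameter sent to infinity, the source of the sign and
    of the quadratic power of [q]. *)
Definition vwp_term (K : numFieldType) (q alpha B C D E w t : K) (k : nat) : K :=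
  (1 - alpha * q ^+ (2 * k)) / (1 - alpha)
  * qpochs q [:: alpha; B; C; D; E] k
  / qpochs q [:: q; D * w; E * w; B * t; C * t] k
  * (- (w * t)) ^+ k * q ^+ 'C(k, 2).

(** This corresponds to the case [alpha u v = q] of the theorem, where only [n = 0] survives on the
    left and the [u], [v] factors cancel on the right. *)
Lemma phi32_vwp (K : numFieldType) (K_complete : geometrically_complete K)
    (q alpha B C D E w t : K) :
  0 < q -> q < 1 -> B * C * t = alpha * q -> D * E * w = alpha * q ->
  alpha != 1 -> `|alpha * q| < 1 -> `|w| < 1 -> `|t| < 1 ->
  `|B * t| < 1 -> `|C * t| < 1 -> `|D * w| < 1 -> `|E * w| < 1 ->
  exists2 S : K, series (vwp_term q alpha B C D E w t) @ \oo --> S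
    & series (phi32_term q B C w (D * w) (E * w) t) @ \oo
      --> qpochs_inf q [:: B * t; C * t] / qpochs_inf q [:: t; alpha * q] * S.
Proof.
move=> q_gt0 q_lt1 BCt DEw a1 aq_lt1 w_lt1 t_lt1 Bt_lt1 Ct_lt1 Dw_lt1 Ew_lt1.
have nz x := fun h k => @mulrX_neq1 K q x k q_gt0 q_lt1 h.
have q1 : `|q| < 1 by rewrite gtr0_norm.
have q0 : q != 0 by rewrite gt_eqF.
have nzp x n (h : `|x| < 1) : qpoch q x n != 0 by apply: qpoch_neq0 => j _; exact: nz.
have nzi x (h : `|x| < 1) : qpoch_inf q x != 0.
  by apply: qpoch_inf_neq0 => //; exact: nz.
(* Summing [f k j] over [j] uses q-Gauss, summing it over [k + j = n] the
   Bailey pair. *)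
pose c k := (1 - alpha * q ^+ (2 * k)) / (1 - alpha)
     * qpochs q [:: alpha; D; E] k / qpochs q [:: q; D * w; E * w] k
     * (- w) ^+ k * q ^+ 'C(k, 2).
pose f k j := c k * (qpoch q B (k + j) * qpoch q C (k + j)
   / (qpoch q q j * qpoch q (alpha * q) (k + k + j))) * t ^+ (k + j).
pose pref := qpochs_inf q [:: B * t; C * t] / qpochs_inf q [:: t; alpha * q].
have [M M0 fM] : norm_bounded (fun i : nat * nat =>
   c i.1 * (qpoch q B (i.1 + i.2) * qpoch q C (i.1 + i.2)
   / (qpoch q q i.2 * qpoch q (alpha * q) (i.1 + i.1 + i.2)))).
  rewrite /c; under eq_fun do rewrite !qpochsE !invfM.
  by repeat first [exact: norm_bounded_cst | apply: norm_boundedM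
    | apply: norm_boundedB | apply: norm_bounded_qpoch
    | apply: norm_bounded_qpochV | apply: norm_boundedX] => //;
    (try exact: nz); rewrite ?normrN ltW.
have f_le k j : `|f k j| <= M * `|t| ^+ (k + j).
  by rewrite normrM normrX ler_wpM2r ?exprn_ge0 //; exact: (fM (k, j)).
have fF k : series (f k) @ \oo --> pref * vwp_term q alpha B C D E w t k.
  (* Row [k] is a q-Gauss sum at [B q^k], [C q^k] and the same [t]. *)
  have xyt : B * q ^+ k * (C * q ^+ k) * t = alpha * q * q ^+ (k + k).
    by rewrite -BCt exprD; ring.
  have aqk : `|alpha * q * q ^+ (k + k)| < 1.
    rewrite (le_lt_trans _ aq_lt1) // normrM ler_piMr // normrX gtr0_norm //.
    by rewrite exprn_ile1 // ltW.
  have := @q_gauss _ K_complete q (B * q ^+ k) (C * q ^+ k) t q_gt0 q_lt1 t_lt1.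
  rewrite xyt => /(_ aqk) gauss.
  have := @cvg_seriesZl _ _ (c k * (qpoch q B k * qpoch q C k)
    * t ^+ k / qpoch q (alpha * q) (k + k)) _ gauss.
  have -> : (fun n => c k * (qpoch q B k * qpoch q C k)
    * t ^+ k / qpoch q (alpha * q) (k + k) *
    (qpochs q [:: B * q ^+ k; C * q ^+ k] n /
       qpochs q [:: q; alpha * q * q ^+ (k + k)] n * t ^+ n)) = f k.
    apply/funext => j; rewrite /f !qpochsE !qpochD !exprD !invfM; ring.
  congr (_ --> _).
  rewrite /pref /vwp_term /c /qpochs_inf !big_cons !big_nil !mulr1 !qpochsE.
  rewrite (qpoch_inf_shift K_complete (B * t) k q_gt0 q_lt1).
  rewrite (qpoch_inf_shift K_complete (C * t) k q_gt0 q_lt1).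
  rewrite (qpoch_inf_shift K_complete (alpha * q) (k + k) q_gt0 q_lt1).
  rewrite -(mulNr w t) exprMn [B * q ^+ k * t]mulrAC [C * q ^+ k * t]mulrAC.
  field.
  by rewrite !nzp ?nzi // subr_eq0 eq_sym a1.
have [s Fs Ds] := fubini_geometric K_complete (normr_ge0 t) t_lt1 f_le fF.
have pref0 : pref != 0.
  by rewrite /pref /qpochs_inf !big_cons !big_nil !mulr1 !mulf_neq0 ?invr_eq0
    ?mulf_neq0 ?nzi.
(* Every row sum carries the nonzero factor [pref], so the very-well-poised sum is their total
   divided by it. *)
exists (pref^-1 * s).
  have := @cvg_seriesZl _ _ pref^-1 _ Fs.
  by under eq_fun do rewrite mulKf //.
rewrite -/pref mulVKf //.
suff -> : phi32_term q B C w (D * w) (E * w) t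
    = (fun n => \sum_(0 <= m < n.+1) f m (n - m)%N) by exact: Ds.
apply/funext => n; symmetry; rewrite /f /phi32_term.
transitivity (qpoch q B n * qpoch q C n * t ^+ n *
  \sum_(0 <= m < n.+1) c m / (qpoch q q (n - m) * qpoch q (alpha * q) (n + m))).
  rewrite mulr_sumr !big_nat; apply: eq_bigr => m /andP[_ mn].
  rewrite -addnA subnKC // addnC; ring.
rewrite bailey_pair_wp //; try by [exact: nz | move=> k; rewrite exprS nz].
rewrite !qpochsE; ring.
Qed.

(** * Expansion in [u] and [v] by the q-Saalschütz sum *)

Lemma bin2_triangle (m j : nat) :
  ('C(m + j, 2) + 'C(m, 2) + m = 'C(j, 2) + (m + j) * m)%N.
Proof.
elim: m => [|m IH]; first by rewrite add0n muln0 !addn0.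
by rewrite addSn !binS !bin1; lia.
Qed.

(** The theorem in the parameters of [phi32_vwp], where the triples [B, C, t] and [D, E, w] are tied
    only by their common product [alpha * q]. *)
Lemma vwp_phi32_transform (K : numFieldType)
    (K_complete : geometrically_complete K) (q alpha u v B C D E w t : K) :
  0 < q -> q < 1 -> B * C * t = alpha * q -> D * E * w = alpha * q ->
  alpha != 1 -> `|alpha * q| < 1 -> `|w| < 1 -> `|t| < 1 ->
  `|B * t| < 1 -> `|C * t| < 1 -> `|D * w| < 1 -> `|E * w| < 1 ->
  u != 0 -> v != 0 ->
  (forall k : nat, alpha * u * q ^+ k != 1) ->
  (forall k : nat, alpha * v * q ^+ k != 1) ->
  let lhs n := qpochs q [:: alpha * u * v / q; B; C; D; E] n * (w * t) ^+ n
      / qpochs q [:: q; alpha * u; alpha * v; D * w; E * w] n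
      * phi32 q (B * q ^+ n) (C * q ^+ n) w (D * w * q ^+ n) (E * w * q ^+ n) t in
  let rhs n := (1 - alpha * q ^+ (2 * n))
      * qpochs q [:: alpha; B; C; D; E; q / u; q / v] n
      / ((1 - alpha)
         * qpochs q [:: q; D * w; E * w; B * t; C * t; alpha * u; alpha * v] n)
      * (- (w * t) * (alpha * u * v / q)) ^+ n * q ^+ 'C(n, 2) in
  [/\ forall n : nat, summable_series (phi32_term q (B * q ^+ n) (C * q ^+ n) w
         (D * w * q ^+ n) (E * w * q ^+ n) t),
      summable_series lhs, summable_series rhs
    & sum_series lhs = qpochs_inf q [:: B * t; C * t]
        / qpochs_inf q [:: t; alpha * q] * sum_series rhs].
Proof.
move=> q_gt0 q_lt1 BCt DEw a1 aq_lt1 w_lt1 t_lt1 Bt_lt1 Ct_lt1 Dw_lt1 Ew_lt1.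
move=> u0 v0 hu hv lhs rhs.
have nz x := fun h k => @mulrX_neq1 K q x k q_gt0 q_lt1 h.
have q1 : `|q| < 1 by rewrite gtr0_norm.
have q0 : q != 0 by rewrite gt_eqF.
have nzp x n (h : `|x| < 1) : qpoch q x n != 0 by apply: qpoch_neq0 => j _; exact: nz.
have nzi x (h : `|x| < 1) : qpoch_inf q x != 0.
  by apply: qpoch_inf_neq0 => //; exact: nz.
have shift x k (h : `|x| < 1) : `|x * q ^+ k| < 1.
  rewrite (le_lt_trans _ h) // normrM ler_piMr // normrX gtr0_norm //.
  by rewrite exprn_ile1 // ltW.
have nu n : qpoch q (alpha * u) n != 0 by apply: qpoch_neq0.
have nv n : qpoch q (alpha * v) n != 0 by apply: qpoch_neq0.
have a1' : 1 - alpha != 0 by rewrite subr_eq0 eq_sym.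
(* The case [n = 0] rests on the hypothesis [a1], as the bound on [alpha * q] does not make the norm
   of [alpha] less than 1. *)
have an1 n : alpha * q ^+ n != 1.
  by case: n => [|n]; rewrite ?expr0 ?mulr1 // exprS mulrA nz.
have an1' n : 1 - alpha * q ^+ n != 0 by rewrite subr_eq0 eq_sym.
pose P := alpha * u * v / q.
(* [h m j] is the double summand: [m] is the q-Saalschütz index, [m + j] the
   index of the right-hand side. *)
pose h m j := (1 - alpha)^-1 * (1 - alpha * q ^+ (2 * (m + j)))
  * qpoch q alpha (m + j + m)
  * (qpochs q [:: B; C; D; E] (m + j)
     / qpochs q [:: D * w; E * w; B * t; C * t] (m + j))
  * (qpoch q P m / qpochs q [:: q; alpha * u; alpha * v] m)
  / qpoch q q j * (- 1) ^+ j * q ^+ 'C(j, 2) * (w * t) ^+ (m + j).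
(* [A m] collects what does not depend on [j]. The rest is the series of [phi32_vwp] at
   [alpha q^(2m)], with [B, C, D, E] multiplied by [q^m], which preserves both product relations. *)
pose A m := qpoch q (alpha * q) (m + m) * qpochs q [:: B; C; D; E] m
  / qpochs q [:: D * w; E * w; B * t; C * t] m * (w * t) ^+ m
  * qpoch q P m / qpochs q [:: q; alpha * u; alpha * v] m.
pose g m := vwp_term q (alpha * q ^+ (m + m)) (B * q ^+ m) (C * q ^+ m)
  (D * q ^+ m) (E * q ^+ m) w t.
have row m j : h m j = A m * g m j.
  rewrite /h /A /g /vwp_term !qpochsE.
  rewrite [(m + j + m)%N]addnAC (qpochD q alpha (m + m) j).
  (* Exchanges the denominator [1 - alpha] for the [1 - alpha q^(2m)] of the shifted series. *)
  have -> : qpoch q alpha (m + m)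
      = (1 - alpha) * qpoch q (alpha * q) (m + m) / (1 - alpha * q ^+ (m + m)).
    by rewrite -qpochSl qpochSr mulfK.
  have -> : q ^+ (2 * (m + j)) = q ^+ (m + m) * q ^+ (2 * j).
    by rewrite mulnDr exprD mul2n -addnn.
  rewrite !qpochD [(w * t) ^+ (m + j)]exprD [(- (w * t)) ^+ j]exprNn.
  rewrite ![_ * q ^+ m * w]mulrAC ![_ * q ^+ m * t]mulrAC.
  by field; rewrite !(nu, nv, a1', an1', nzp) ?shift.
have binom_q m j : q ^+ 'C(m + j, 2)
    = q ^+ 'C(j, 2) * q ^+ ((m + j) * m) / (q ^+ 'C(m, 2) * q ^+ m).
  apply: (canRL (mulfK _)); first by rewrite mulf_neq0 ?expf_neq0.
  by rewrite -!exprD addnA bin2_triangle.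
have diag n : \sum_(0 <= m < n.+1) h m (n - m)%N = rhs n.
  (* The middle form is [rhs n] with its dependence on [u] and [v] expanded by q-Saalschütz. *)
  transitivity ((1 - alpha * q ^+ (2 * n)) * qpochs q [:: alpha; B; C; D; E] n
     / ((1 - alpha) * qpochs q [:: q; D * w; E * w; B * t; C * t] n)
     * (- (w * t)) ^+ n * q ^+ 'C(n, 2) *
     \sum_(0 <= m < n.+1)
       qpochs q [:: q ^- n; alpha * q ^+ n; P] m * q ^+ m
       / qpochs q [:: q; alpha * u; alpha * v] m); last first.
    rewrite q_saalschutz //; last by move=> k; rewrite exprS nz.
    rewrite /rhs -/P !qpochsE [(- (w * t) * P) ^+ n]exprMn.
    by field; rewrite !(nu, nv, a1', nzp).
  rewrite mulr_sumr !big_nat; apply: eq_bigr => m /andP[_]; rewrite ltnS => mn.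
  have := @qpoch_neg_exp _ q n m q0 mn.
  move: (n - m)%N (subnKC mn) => j <- {n mn} Vq.
  (* The numerator [(q)_(m+j)] cancels against the outer factor and leaves [1 / (q)_j]. *)
  have -> : qpochs q [:: q ^- (m + j); alpha * q ^+ (m + j); P] m
      = qpoch q q (m + j) * (- 1) ^+ m * q ^+ 'C(m, 2)
        / (qpoch q q j * q ^+ ((m + j) * m))
        * (qpoch q (alpha * q ^+ (m + j)) m * qpoch q P m).
    rewrite -Vq qpochsE !qpochsE; field.
    by rewrite nzp // expf_neq0.
  rewrite /h !qpochsE (qpochD q alpha (m + j) m) binom_q.
  rewrite [(- (w * t)) ^+ (m + j)]exprNn [(-1) ^+ (m + j)]exprD.
  have sgn : (-1) ^+ m * (-1) ^+ m = 1 :> K by rewrite -expr2 sqrr_sign.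
  have qm : q ^+ m != 0 by rewrite expf_neq0.
  have qc : q ^+ 'C(m, 2) != 0 by rewrite expf_neq0.
  have qmj : q ^+ ((m + j) * m) != 0 by rewrite expf_neq0.
  move: (q ^+ m) qm ((-1) ^+ m) sgn => M M0 s sgn.
  by field: sgn; rewrite !(nu, nv, a1', nzp) ?M0 ?qc ?qmj.
(* All of [h] but the power of [w * t] is bounded, so that power dominates the double series. *)
have P_bounded : norm_bounded (fun i : nat * nat =>
  (1 - alpha)^-1 * (1 - alpha * q ^+ (2 * (i.1 + i.2)))
  * qpoch q alpha (i.1 + i.2 + i.1)
  * (qpochs q [:: B; C; D; E] (i.1 + i.2)
     / qpochs q [:: D * w; E * w; B * t; C * t] (i.1 + i.2))
  * (qpoch q P i.1 / qpochs q [:: q; alpha * u; alpha * v] i.1)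
  / qpoch q q i.2 * (- 1) ^+ i.2 * q ^+ 'C(i.2, 2)).
  under eq_fun do rewrite !qpochsE !invfM.
  by repeat first [exact: norm_bounded_cst | apply: norm_boundedM
    | apply: norm_boundedB | apply: norm_bounded_qpoch
    | apply: norm_bounded_qpochV | apply: norm_boundedX] => //;
    (try exact: nz); rewrite ?normrN ?normr1 // ltW.
have wt_lt1 : `|w * t| < 1 by rewrite normrM mulr_ilt1.
have [M M0 hM] := P_bounded.
have h_le m j : `|h m j| <= M * `|w * t| ^+ (m + j).
  by rewrite /h normrM normrX ler_wpM2r ?exprn_ge0 //; exact: (hM (m, j)).
pose pref m := qpochs_inf q [:: B * q ^+ m * t; C * q ^+ m * t]
  / qpochs_inf q [:: t; alpha * q ^+ (m + m) * q].
have base m : exists2 S : K, series (g m) @ \oo --> S &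
    series (phi32_term q (B * q ^+ m) (C * q ^+ m) w
         (D * w * q ^+ m) (E * w * q ^+ m) t) @ \oo --> pref m * S.
  rewrite [D * w * _]mulrAC [E * w * _]mulrAC; apply: phi32_vwp => //.
  - rewrite [alpha * _ * q]mulrAC -BCt exprD; ring.
  - rewrite [alpha * _ * q]mulrAC -DEw exprD; ring.
  - by rewrite mulrAC shift.
  - by rewrite mulrAC shift.
  - by rewrite mulrAC shift.
  - by rewrite mulrAC shift.
  - by rewrite mulrAC shift.
have /choice[S SE] : forall m, exists S : K, series (g m) @ \oo --> S /\
    series (phi32_term q (B * q ^+ m) (C * q ^+ m) w
         (D * w * q ^+ m) (E * w * q ^+ m) t) @ \oo --> pref m * S.
  by move=> m; have [S] := base m; exists S.
have hF m : series (h m) @ \oo --> A m * S m.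
  have := @cvg_seriesZl _ _ (A m) _ (SE m).1.
  by under eq_fun do rewrite -row.
have [s Fs Ds] := fubini_geometric K_complete (normr_ge0 _) wt_lt1 h_le hF.
have rhs_s : series rhs @ \oo --> s.
  by suff -> : rhs = (fun n => \sum_(0 <= m < n.+1) h m (n - m)%N);
    [exact: Ds | apply/funext => n; rewrite diag].
(* [phi32] is a [limn]; the convergence in [SE] identifies its value. *)
have phiE n : phi32 q (B * q ^+ n) (C * q ^+ n) w (D * w * q ^+ n) (E * w * q ^+ n) t
    = pref n * S n.
  apply: (@cvg_uniq _ _ _ _ _ (SE n).2); apply/cvg_ex; exists (pref n * S n).
  exact: (SE n).2.
(* The shifted infinite products in [pref n] combine with the finite products in [A n] into
   unshifted ones, independent of [n]. *)
have lhs_s : series lhs @ \oo --> qpochs_inf q [:: B * t; C * t]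
        / qpochs_inf q [:: t; alpha * q] * s.
  suff -> : lhs = (fun n => qpochs_inf q [:: B * t; C * t]
        / qpochs_inf q [:: t; alpha * q] * (A n * S n)) by exact: cvg_seriesZl.
  apply/funext => n; rewrite /lhs phiE /A /pref /qpochs_inf !big_cons !big_nil.
  rewrite !mulr1 !qpochsE [alpha * _ * q]mulrAC.
  rewrite (qpoch_inf_shift K_complete (B * t) n q_gt0 q_lt1).
  rewrite (qpoch_inf_shift K_complete (C * t) n q_gt0 q_lt1).
  rewrite (qpoch_inf_shift K_complete (alpha * q) (n + n) q_gt0 q_lt1).
  rewrite [B * q ^+ n * t]mulrAC [C * q ^+ n * t]mulrAC.
  by field; rewrite !(nu, nv, nzp, nzi) ?shift.
split.
- by move=> n; apply/cvg_ex; exists (pref n * S n); exact: (SE n).2.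
- by apply/cvg_ex; exists (qpochs_inf q [:: B * t; C * t]
        / qpochs_inf q [:: t; alpha * q] * s).
- by apply/cvg_ex; exists s.
- have -> : sum_series rhs = s.
    by apply: (cvg_uniq _ rhs_s); apply/cvg_ex; exists s.
  by apply: (cvg_uniq _ lhs_s); apply/cvg_ex; eexists; exact: lhs_s.
Qed.

(* Specialization to the parameters [a], [b], [c], [d], [r] *)
Local Close Scope classical_set_scope.

Theorem theorem6p4 (R : realType) (q0 : R) (q a b c d r u v alpha : R[i])
  (q0_gt0 : 0 < q0) (q0_lt1 : q0 < 1) (qE : q = q0%:C)
  (a_lt1 : `|a| < 1) (b_lt1 : `|b| < 1) (c_lt1 : `|c| < 1)
  (d_lt1 : `|d| < 1) (r_lt1 : `|r| < 1)
  (alphaE : alpha = a ^+ 2 * b * c * d * r / q)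
  (u_neq0 : u != 0) (v_neq0 : v != 0) (alpha_neq1 : alpha != 1)
  (alphau_neq1 : forall n : nat, alpha * u * q ^+ n != 1)
  (alphav_neq1 : forall n : nat, alpha * v * q ^+ n != 1) :
  let lhs_term (n : nat) : R[i] :=
    qpochs q [:: alpha * u * v / q; a * b; a * c; a * d; a * r] n
      * (b * c * d * r) ^+ n
      / qpochs q [:: q; alpha * u; alpha * v; a * b * c * d; a * b * c * r] n
      * phi32 q (a * b * q ^+ n) (a * c * q ^+ n) (b * c)
          (a * b * c * d * q ^+ n) (a * b * c * r * q ^+ n) (d * r) in
  let rhs_term (n : nat) : R[i] :=
    (1 - alpha * q ^+ (2 * n))
      * qpochs q [:: alpha; a * b; a * c; a * d; a * r; q / u; q / v] n
      / ((1 - alpha)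
         * qpochs q [:: q; a * b * c * d; a * b * c * r; a * b * d * r;
                        a * c * d * r; alpha * u; alpha * v] n)
      * (- (alpha * b * c * d * r * u * v / q)) ^+ n
      * q ^+ (n * (n - 1) %/ 2) in
  [/\ forall n : nat,
        summable_series
          (phi32_term q (a * b * q ^+ n) (a * c * q ^+ n) (b * c)
             (a * b * c * d * q ^+ n) (a * b * c * r * q ^+ n) (d * r)),
      summable_series lhs_term,
      summable_series rhs_term
    & sum_series lhs_term
      = qpochs_inf q [:: a * b * d * r; a * c * d * r]
          / qpochs_inf q [:: d * r; q * alpha]
        * sum_series rhs_term].
Proof.
move=> lhs_term rhs_term.
have q_gt0 : 0 < q by rewrite qE ltcR.
have q_lt1 : q < 1 by rewrite qE ltcR.
have q_neq0 : q != 0 by rewrite gt_eqF.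
have lt1M (x y : R[i]) : `|x| < 1 -> `|y| < 1 -> `|x * y| < 1.
  by move=> x_lt1 y_lt1; rewrite normrM mulr_ilt1.
have aq : alpha * q = a ^+ 2 * b * c * d * r by rewrite alphaE divfK.
have abcdE : a * d * (b * c) = a * b * c * d by rewrite mulrACA mulrA mulrAC.
have abcrE : a * r * (b * c) = a * b * c * r by ring.
have abdrE : a * b * (d * r) = a * b * d * r by rewrite mulrA.
have acdrE : a * c * (d * r) = a * c * d * r by rewrite mulrA.
have bcdrE : b * c * (d * r) = b * c * d * r by rewrite mulrA.
(* These two factorizations of [a^2 b c d r] are what the choice of [alpha] provides for. *)
have BCt : a * b * (a * c) * (d * r) = alpha * q by rewrite aq; ring.
have DEw : a * d * (a * r) * (b * c) = alpha * q by rewrite aq; ring.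
have aq_lt1 : `|alpha * q| < 1 by rewrite -BCt !lt1M.
have w_lt1 : `|b * c| < 1 by rewrite lt1M.
have t_lt1 : `|d * r| < 1 by rewrite lt1M.
have Bt_lt1 : `|a * b * (d * r)| < 1 by rewrite !lt1M.
have Ct_lt1 : `|a * c * (d * r)| < 1 by rewrite !lt1M.
have Dw_lt1 : `|a * d * (b * c)| < 1 by rewrite !lt1M.
have Ew_lt1 : `|a * r * (b * c)| < 1 by rewrite !lt1M.
have := @vwp_phi32_transform _ (@complex_geometrically_complete R) q alpha u v
  (a * b) (a * c) (a * d) (a * r) (b * c) (d * r) q_gt0 q_lt1 BCt DEw
  alpha_neq1 aq_lt1 w_lt1 t_lt1 Bt_lt1 Ct_lt1 Dw_lt1 Ew_lt1 u_neq0 v_neq0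
  alphau_neq1 alphav_neq1.
rewrite abcdE abcrE abdrE acdrE bcdrE [alpha * q]mulrC /= -/lhs_term.
(* Only the powers are written differently: the base is regrouped and [n (n - 1) / 2] becomes a
   binomial coefficient. *)
suff -> : rhs_term = fun n => (1 - alpha * q ^+ (2 * n))
      * qpochs q [:: alpha; a * b; a * c; a * d; a * r; q / u; q / v] n
      / ((1 - alpha)
         * qpochs q [:: q; a * b * c * d; a * b * c * r; a * b * d * r;
                        a * c * d * r; alpha * u; alpha * v] n)
      * (- (b * c * d * r) * (alpha * u * v / q)) ^+ n * q ^+ 'C(n, 2) by [].
apply/funext => n; rewrite /rhs_term; congr (_ * _ ^+ _ * _ ^+ _).
  by ring.
by rewrite bin2 subn1 divn2.
Qed.
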